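(* Let $r>0$ and let $d$ be the Attouch–Wets metric on $\Gamma_0(\mathbb{R}^n)$, $$d(f,g)=\sum_{i=1}^\infty\frac1{2^i}\frac{\sup_{\|x\|\le i}|e_rf(x)-e_rg(x)|}{1+\sup_{\|x\|\le i}|e_rf(x)-e_rg(x)|}.$$ Let $S=\{f=q_A(\cdot-a)+\langle b,\cdot\rangle+c:\ A\in\mathcal{A},\ a,b\in\mathbb{R}^n,\ c\in\mathbb{R},\ f\in\Gamma_0(\mathbb{R}^n)\}$ and $T=\{f=q_A+\langle b,\cdot\rangle+c:\ A\in\mathcal{A},\ b\in\mathbb{R}^n,\ c\in\mathbb{R},\ f\in\Gamma_0(\mathbb{R}^n)\}$. Then: (i) $(S,d)$ is a complete metric space; (ii) $f\in S\Rightarrow f^*\in S$; (iii) if $f\in S$ has the form above with $b=0$, then $f^*\in T$; (iv) if $f\in S$ (resp. $f\in T$) and $\lambda>0$, then $\lambda f\in S$ (resp. $\lambda f\in T$); (v) $f_1,f_2\in T\Rightarrow f_1+f_2\in T$.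
   Context: $\Gamma_0(\mathbb{R}^n)$: proper convex lsc functions on $\mathbb{R}^n$. $e_rf(x)=\inf_y\{f(y)+\frac r2\|y-x\|^2\}$. $\mathcal{A}$ is the set of maximally monotone symmetric linear relations on $\mathbb{R}^n$ (linear relation: operator $\mathbb{R}^n\rightrightarrows\mathbb{R}^n$ with linear-subspace graph; symmetric: $\langle x,y^*\rangle=\langle y,x^*\rangle$ on the graph). $q_A(x)=\frac12\langle x,Ax\rangle$ on $\operatorname{dom}A$, $\infty$ elsewhere. $^*$ is the Fenchel conjugate. *)

(* Defs.v *)
From HB Require Import structures.
From mathcomp Require Import all_boot all_order all_algebra.
From mathcomp Require Import all_classical all_reals all_analysis.
Set Implicit Arguments. Unset Strict Implicit. Unset Printing Implicit Defensive.
Import Order.TTheory GRing.Theory Num.Theory.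
Import numFieldNormedType.Exports.
Local Open Scope classical_set_scope.
Local Open Scope ring_scope.

Section Defs.
Variables (R : realType) (n : nat).
Local Notation V := 'rV[R]_n.

Definition dot (x y : V) : R := \sum_(i < n) x ord0 i * y ord0 i.
Definition enorm (x : V) : R := Num.sqrt (dot x x).

Definition proper_fun (f : V -> \bar R) : Prop :=
  (forall x, f x != -oo%E) /\ (exists x, (f x < +oo)%E).
Definition convex_fun (f : V -> \bar R) : Prop :=
  forall (x y : V) (t : R), 0 < t < 1 ->
    (f (t *: x + (1 - t) *: y)%R <= t%:E * f x + (1 - t)%:E * f y)%E.
Definition lsc_fun (f : V -> \bar R) : Prop :=
  forall (x : V) (a : R), (a%:E < f x)%E ->
    exists2 e : R, 0 < e & forall y : V, enorm (y - x) < e -> (a%:E < f y)%E.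
Definition Gamma0 (f : V -> \bar R) : Prop :=
  [/\ proper_fun f, convex_fun f & lsc_fun f].

(* Moreau envelope e_r f(x) = inf_y { f y + r/2 ||y - x||^2 } (finite on Gamma0) *)
Definition env (r : R) (f : V -> \bar R) (x : V) : R :=
  fine (ereal_inf [set (f y + (r / 2 * enorm (y - x) ^+ 2)%R%:E)%E | y in [set: V]]).

Definition sup_ball (r : R) (f g : V -> \bar R) (i : nat) : R :=
  sup [set `|env r f x - env r g x| | x in [set x : V | enorm x <= i%:R]].

Definition AW_dist (r : R) (f g : V -> \bar R) : R :=
  limn (fun N => \sum_(1 <= i < N) ((2 ^+ i)^-1 * (sup_ball r f g i / (1 + sup_ball r f g i)))).

Definition metric_on (S : set (V -> \bar R)) (d : (V -> \bar R) -> (V -> \bar R) -> R) : Prop :=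
  forall f g h, S f -> S g -> S h ->
    [/\ 0 <= d f g, d f g = 0 <-> f = g, d f g = d g f & d f h <= d f g + d g h].
Definition complete_on (S : set (V -> \bar R)) (d : (V -> \bar R) -> (V -> \bar R) -> R) : Prop :=
  forall u : nat -> V -> \bar R, (forall k, S (u k)) ->
    (forall e : R, 0 < e -> exists N, forall k m, (N <= k)%N -> (N <= m)%N -> d (u k) (u m) < e) ->
    exists2 f, S f & (forall e : R, 0 < e -> exists N, forall k, (N <= k)%N -> d (u k) f < e).

(* linear relations as graphs G : V -> V -> Prop (G x x* means x* in A x) *)
Definition linear_relation (G : V -> V -> Prop) : Prop :=
  [/\ G 0 0,
      forall x xs y ys, G x xs -> G y ys -> G (x + y) (xs + ys)
    & forall (t : R) x xs, G x xs -> G (t *: x) (t *: xs)].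
Definition symmetric_rel (G : V -> V -> Prop) : Prop :=
  forall x xs y ys, G x xs -> G y ys -> dot x ys = dot y xs.
Definition monotone_rel (G : V -> V -> Prop) : Prop :=
  forall x xs y ys, G x xs -> G y ys -> 0 <= dot (x - y) (xs - ys).
Definition maximally_monotone (G : V -> V -> Prop) : Prop :=
  monotone_rel G /\
  forall x xs, (forall y ys, G y ys -> 0 <= dot (x - y) (xs - ys)) -> G x xs.
Definition classA (G : V -> V -> Prop) : Prop :=
  [/\ linear_relation G, maximally_monotone G & symmetric_rel G].

(* q_A(x) = 1/2 <x, A x> on dom A (well defined by symmetry), +oo elsewhere
   (ereal_inf of the empty set is +oo) *)
Definition qA (G : V -> V -> Prop) (x : V) : \bar R :=
  ereal_inf [set ((2^-1) * dot x xs)%:E | xs in G x].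

Definition setS : set (V -> \bar R) :=
  [set f | Gamma0 f /\ exists G a b (c : R), classA G /\
     f = (fun x => qA G (x - a)%R + (dot b x)%:E + c%:E)%E].
Definition setT_ : set (V -> \bar R) :=
  [set f | Gamma0 f /\ exists G b (c : R), classA G /\
     f = (fun x => qA G x + (dot b x)%:E + c%:E)%E].

Definition fconj (f : V -> \bar R) : V -> \bar R :=
  fun y => ereal_sup [set ((dot x y)%:E - f x)%E | x in [set: V]].

End Defs.

(* Main.v *)
(* Everything is read off the Moreau envelope. With J = (Id + A/r)^-1, which is
   everywhere defined by Minty's argument, the envelope of
   q_A(. - a) + <b, .> + c is a quadratic function
   (r/2) <x, x - J x> + <p, x> + s, where J is symmetric with
   <J x, x - J x> >= 0; conversely all such J, p, s occur (take b = p and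
   a = - p / r). A function equal to a conjugate is recovered from its envelope
   as f(y) = sup_x (e_r f(x) - (r/2) |y - x|^2), so the envelope is injective on
   S. A d-Cauchy sequence has envelopes converging uniformly on balls, and the
   set of quadratic functions above is closed under pointwise limits because the
   coefficients are recovered by polarization: hence completeness.
   The conjugate of q_A(. - a) + <b, .> + c is
   q_{A^-1}(. - b) + <a, .> - <a, b> - c; in particular all these functions are
   conjugates, which yields convexity and lower semicontinuity. For sums, A + B is
   maximal because (A + B)(0) contains (dom A)^perp + (dom B)^perp, the orthogonal
   complement of dom (A + B). *)

Require Import Defs.
From HB Require Import structures.
From mathcomp Require Import all_boot all_order all_algebra.
From mathcomp Require Import all_classical all_reals all_analysis.
From mathcomp Require Import ring lra.
Set Implicit Arguments. Unset Strict Implicit. Unset Printing Implicit Defensive.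
Import Order.TTheory GRing.Theory Num.Theory.
Import numFieldNormedType.Exports.
Local Open Scope classical_set_scope.
Local Open Scope ring_scope.

(** * Euclidean geometry of row vectors and double orthogonal complements *)

Section InnerProduct.
Variables (R : realType) (n : nat).
Local Notation V := 'rV[R]_n.
Implicit Types (x y z : V) (t : R) (P : V -> Prop).

Lemma dotC x y : dot x y = dot y x.
Proof. by apply: eq_bigr => i _; rewrite mulrC. Qed.

Lemma dotDl x y z : dot (x + y) z = dot x z + dot y z.
Proof. by rewrite -big_split; apply: eq_bigr => i _; rewrite mxE mulrDl. Qed.

Lemma dotZl t x y : dot (t *: x) y = t * dot x y.
Proof. by rewrite /dot mulr_sumr; apply: eq_bigr => i _; rewrite mxE mulrA. Qed.

Lemma dotDr x y z : dot x (y + z) = dot x y + dot x z.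
Proof. by rewrite dotC dotDl !(dotC _ x). Qed.

Lemma dotZr t x y : dot x (t *: y) = t * dot x y.
Proof. by rewrite dotC dotZl dotC. Qed.

Lemma dotNl x y : dot (- x) y = - dot x y.
Proof. by rewrite -scaleN1r dotZl mulN1r. Qed.

Lemma dotNr x y : dot x (- y) = - dot x y.
Proof. by rewrite dotC dotNl dotC. Qed.

Lemma dot0l x : dot 0 x = 0.
Proof. by rewrite -(scale0r (0 : V)) dotZl mul0r. Qed.

Lemma dot0r x : dot x 0 = 0.
Proof. by rewrite dotC dot0l. Qed.

Definition dotE := (dotDl, dotDr, dotNl, dotNr, dotZl, dotZr, dot0l, dot0r).

Lemma dot_ge0 x : 0 <= dot x x.
Proof. by apply: sumr_ge0 => i _; rewrite -expr2 sqr_ge0. Qed.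

Lemma dot_eq0 x : dot x x = 0 -> x = 0.
Proof.
move=> x0; apply/rowP => i; rewrite mxE.
have ge0 (j : 'I_n) : true -> 0 <= x ord0 j * x ord0 j.
  by rewrite -expr2 sqr_ge0.
have /eqP := psumr_eq0P ge0 x0 (isT : xpredT i).
by rewrite mulf_eq0 orbb => /eqP.
Qed.

Lemma enorm_ge0 x : 0 <= enorm x.
Proof. exact: sqrtr_ge0. Qed.

Lemma enorm_sq x : enorm x ^+ 2 = dot x x.
Proof. by rewrite sqr_sqrtr // dot_ge0. Qed.

Lemma CauchySchwarz x y : `|dot x y| <= enorm x * enorm y.
Proof.
have sq : dot x y ^+ 2 <= dot x x * dot y y.
  have [y0|y0] := eqVneq (dot y y) 0.
    by rewrite (dot_eq0 y0) !dot0r expr0n mulr0.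
  have yp : 0 < dot y y by rewrite lt_def y0 dot_ge0.
  (* The squared norm of this vector is <y, y> times the gap in the inequality. *)
  have := dot_ge0 (dot y y *: x - dot x y *: y).
  rewrite !dotE (dotC y x).
  rewrite [X in 0 <= X](_ : _ = dot y y * (dot x x * dot y y - dot x y ^+ 2)).
    by rewrite pmulr_rge0 // subr_ge0.
  by ring.
rewrite -(@ler_pXn2r _ 2) ?nnegrE ?mulr_ge0 ?enorm_ge0 //.
by rewrite exprMn !enorm_sq real_normK ?num_real.
Qed.

Lemma dot_delta x (i : 'I_n) : dot x (delta_mx 0 i) = x ord0 i.
Proof.
rewrite /dot (bigD1 i) //= big1 => [|j ji].
  by rewrite addr0 mxE !eqxx mulr1.
by rewrite mxE (negbTE ji) andbF mulr0.
Qed.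

Definition linear_closed P :=
  [/\ P 0, forall x y, P x -> P y -> P (x + y) & forall t x, P x -> P (t *: x)].

(** Take a matrix of maximal rank among those whose row space lies in [P]; a vector of [P] outside
    that row space could be adjoined and would raise the rank. *)
Lemma linear_closed_row_space P : linear_closed P ->
  exists A : 'M[R]_n, forall x, P x <-> (x <= A)%MS.
Proof.
case=> P0 PD PZ.
pose ok k := `[< exists2 A : 'M[R]_n, (forall x, (x <= A)%MS -> P x) & \rank A = k >].
have ex0 : exists k, ok k.
  exists 0%N; apply/asboolP; exists 0; last by rewrite mxrank0.
  by move=> x /submx0null ->.
have ub k : ok k -> (k <= n)%N.
  by move=> /asboolP[A _ <-]; exact: rank_leq_row.
case: (ex_maxnP ex0 ub) => k /asboolP[A AP <-] maxA.
exists A => x; split; last exact: AP.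
move=> Px; apply: contrapT => /negP xA.
have : ok (\rank (A + x)%MS).
  apply/asboolP; exists (A + x)%MS => // y /sub_addsmxP[[u v] /= ->].
  apply: PD; first by apply: AP; exact: submxMl.
  by rewrite (mx11_scalar v) mul_scalar_mx; exact: PZ.
move=> /maxA; apply/negP; rewrite -ltnNge; apply: rank_ltmx.
by rewrite ltmxE addsmxSl /=; apply: contra xA; apply: submx_trans; exact: addsmxSr.
Qed.

(** The columns of [cokermx A] are orthogonal to the row space of [A], and a vector orthogonal to
    all of them lies in that row space. *)
Lemma perp_perp P x : linear_closed P ->
  (forall v, (forall y, P y -> dot v y = 0) -> dot v x = 0) -> P x.
Proof.
move=> /linear_closed_row_space[A PA] xperp; apply/PA; rewrite submxE.
have dotcol y (j : 'I_n) : dot (row j (cokermx A)^T) y = (y *m cokermx A) ord0 j.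
  by rewrite mxE; apply: eq_bigr => i _; rewrite !mxE mulrC.
apply/eqP/rowP => j; rewrite -dotcol mxE; apply: xperp => y /PA/submxP[D ->].
by rewrite dotcol -mulmxA mulmx_coker mulmx0 mxE.
Qed.

End InnerProduct.

(** * Maximally monotone symmetric linear relations *)

Section LinearRelations.
Variables (R : realType) (n : nat).
Local Notation V := 'rV[R]_n.
Local Notation graph := (V -> V -> Prop).
Implicit Types (G H : graph) (a b u v x y : V) (c l : R) (f g : V -> \bar R).

Definition graph_inv G : graph := fun x y => G y x.
Definition graph_scale l G : graph := fun x y => exists2 z, G x z & y = l *: z.
Definition graph_add G H : graph :=
  fun x y => exists z w, [/\ G x z, H x w & y = z + w].

Lemma classA_inv G : classA G -> classA (graph_inv G).
Proof.
case=> [[G0 GD GZ] [Gm Gmax] Gs]; split.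
- split=> //.
  + by move=> x xs y ys; exact: GD.
  + by move=> t x xs; exact: GZ.
- split.
  + by move=> x xs y ys Gx Gy; rewrite dotC; exact: Gm.
  + by move=> x xs Gx; apply: Gmax => y ys Gy; rewrite dotC; exact: Gx.
- by move=> x xs y ys Gx Gy; rewrite dotC (Gs _ _ _ _ Gy Gx) dotC.
Qed.

Lemma classA_scale l G : 0 < l -> classA G -> classA (graph_scale l G).
Proof.
move=> l0 [[G0 GD GZ] [Gm Gmax] Gs]; split.
- split.
  + by exists 0; rewrite ?scaler0.
  + move=> x xs y ys [z Gz ->] [w Gw ->]; exists (z + w); rewrite ?scalerDr //.
    exact: GD.
  + move=> t x xs [z Gz ->]; exists (t *: z); first exact: GZ.
    by rewrite !scalerA mulrC.
- split.
  + move=> x xs y ys [z Gz ->] [w Gw ->].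
    by rewrite -scalerBr dotZr pmulr_rge0 //; exact: Gm.
  + move=> x xs Gx; exists (l^-1 *: xs); last by rewrite scalerA divff ?gt_eqF // scale1r.
    apply: Gmax => y ys Gy.
    have := Gx y (l *: ys) (ex_intro2 _ _ _ Gy erefl).
    rewrite -(pmulr_rge0 (dot (x - y) (l^-1 *: xs - ys)) l0) -dotZr scalerBr scalerA.
    by rewrite divff ?gt_eqF // scale1r.
- by move=> x xs y ys [z Gz ->] [w Gw ->]; rewrite !dotZr (Gs _ _ _ _ Gz Gw).
Qed.

Lemma dom_linear_closed G : linear_relation G -> linear_closed (fun x => exists y, G x y).
Proof.
case=> G0 GD GZ; split; first by exists 0.
- by move=> x y [xs Gx] [ys Gy]; exists (xs + ys); exact: GD.
- by move=> t x [xs Gx]; exists (t *: xs); exact: GZ.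
Qed.

Lemma image0_linear_closed G : linear_relation G -> linear_closed (G 0).
Proof.
case=> G0 GD GZ; split=> //.
- by move=> x y Gx Gy; rewrite -(addr0 0); exact: GD.
- by move=> t x Gx; rewrite -(scaler0 _ t); exact: GZ.
Qed.

Lemma classA_ge0 G x xs : classA G -> G x xs -> 0 <= dot x xs.
Proof.
case=> [[G0 _ _] [Gm _] _] Gx.
by have := Gm _ _ _ _ Gx G0; rewrite !subr0.
Qed.

(** Against a graph point (y, ys) the pair (0, v) gives <y, ys> - <y, v> = <y, ys> >= 0, so
    maximality admits it. *)
Lemma classA_perp_dom G v : classA G ->
  (forall x xs, G x xs -> dot v x = 0) -> G 0 v.
Proof.
move=> cG vG; case: (cG) => _ [_ Gmax] _; apply: Gmax => y ys Gy.
have := classA_ge0 cG Gy; have := vG _ _ Gy.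
by rewrite !dotE (dotC v) => ->; lra.
Qed.

Lemma classA_perp_ran G v : classA G ->
  (forall x xs, G x xs -> dot v xs = 0) -> G v 0.
Proof.
move=> /classA_inv cG vG.
by apply: (classA_perp_dom cG) => x xs; exact: vG.
Qed.

(** A converse to [classA_perp_dom]. If a pair is monotonically related to [G], its first entry lies
    in the domain, since otherwise multiples of some v in [G 0] violate the inequality; its second
    entry then differs from a value of [G] by a vector orthogonal to the domain. *)
Lemma linear_maximal G : linear_relation G -> monotone_rel G ->
  (forall v, (forall x xs, G x xs -> dot v x = 0) -> G 0 v) ->
  maximally_monotone G.
Proof.
move=> lG Gm G0perp; split=> // x xs Gx; case: (lG) => G0 GD GZ.
have quad0 (p q : R) : (forall t, 0 <= t * p + t ^+ 2 * q) -> p = 0.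
  move=> pq; apply/eqP; apply: contraT => p0.
  have p2 : 0 < p ^+ 2 by rewrite exprn_even_gt0.
  have q1 : 0 < `|q| + 1 by rewrite ltr_wpDl.
  (* At this t the quadratic is p^2 / (|q| + 1)^2 times q - |q| - 1, which is negative. *)
  have := pq (- p / (`|q| + 1)).
  have -> : - p / (`|q| + 1) * p + (- p / (`|q| + 1)) ^+ 2 * q
     = p ^+ 2 / (`|q| + 1) ^+ 2 * (q - `|q| - 1).
    by field; rewrite gt_eqF.
  rewrite pmulr_rge0; last by rewrite divr_gt0 // exprn_gt0.
  by have := ler_norm q; lra.
have [xs0 Gx0] : exists xs0, G x xs0.
  apply: (perp_perp (dom_linear_closed lG)) => v vG.
  have Gv : G 0 v by apply: G0perp => y ys Gy; apply: vG; exists ys.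
  apply/eqP; apply: contraT => vx0.
  (* The multiple makes the pairing equal to <x, xs> - (<x, xs> + 1) = -1. *)
  have := Gx 0 (((dot x xs + 1) / dot v x) *: v).
  have {1}<- : ((dot x xs + 1) / dot v x) *: 0 = 0 :> V by rewrite scaler0.
  move=> /(_ (GZ _ _ _ Gv)); rewrite subr0 !dotE (dotC x v) mulfVK //; lra.
have -> : xs = xs0 + (xs - xs0) by rewrite addrC subrK.
rewrite -(addr0 x); apply: (GD) => //; apply: G0perp => u us Gu; rewrite dotC.
apply: (@quad0 _ (dot u us)) => t.
(* Moving along -t u gives t <u, xs - xs0> + t^2 <u, us> >= 0 for every t. *)
have := Gx _ _ (GD _ _ _ _ Gx0 (GZ (- t) _ _ Gu)).
by rewrite opprD addrA subrr add0r !dotE; lra.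
Qed.

Lemma classA_add G H : classA G -> classA H -> classA (graph_add G H).
Proof.
move=> cG cH.
case: (cG) => lG [Gm _] Gs; case: (cH) => lH [Hm _] Hs.
have lGH : linear_relation (graph_add G H).
  case: lG lH => G0 GD GZ [H0 HD HZ]; split.
  - by exists 0, 0; rewrite addr0.
  - move=> x _ y _ [z [w [Gz Hw ->]]] [z' [w' [Gz' Hw' ->]]].
    by exists (z + z'), (w + w'); split; [exact: GD|exact: HD|rewrite addrACA].
  - move=> t x _ [z [w [Gz Hw ->]]].
    by exists (t *: z), (t *: w); rewrite scalerDr; split; [exact: GZ|exact: HZ|].
split=> //.
- apply: linear_maximal => //.
  + move=> x _ y _ [z [w [Gz Hw ->]]] [z' [w' [Gz' Hw' ->]]].
    have := Gm _ _ _ _ Gz Gz'; have := Hm _ _ _ _ Hw Hw'; rewrite !dotE; lra.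
  + move=> v vD.
    pose P y := exists z w, [/\ G 0 z, H 0 w & y = z + w].
    have lP : linear_closed P by exact: (image0_linear_closed lGH).
    (* Since [G 0] and [H 0] contain the orthogonal complements of the two domains, a vector u
       orthogonal to both lies in both domains, hence is orthogonal to v. *)
    apply: (perp_perp lP) => u uP; rewrite dotC.
    have lG0 := image0_linear_closed lG; have lH0 := image0_linear_closed lH.
    have [z Gz] : exists z, G u z.
      apply: (perp_perp (dom_linear_closed lG)) => w wG; rewrite dotC; apply: uP.
      exists w, 0; rewrite addr0; split=> //; last by case: lH0.
      by apply: classA_perp_dom => // x xs Gx; apply: wG; exists xs.
    have [w Hw] : exists w, H u w.
      apply: (perp_perp (dom_linear_closed lH)) => w wH; rewrite dotC; apply: uP.
      exists 0, w; rewrite add0r; split=> //; first by case: lG0.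
      by apply: classA_perp_dom => // x xs Hx; apply: wH; exists xs.
    by apply: (vD u (z + w)); exists z, w.
- move=> x _ y _ [z [w [Gz Hw ->]]] [z' [w' [Gz' Hw' ->]]].
  by rewrite !dotDr (Gs _ _ _ _ Gz Gz') (Hs _ _ _ _ Hw Hw').
Qed.

(** * Generalized linear-quadratic functions and their Fenchel conjugates *)

Lemma qAE G x xs : symmetric_rel G -> G x xs -> qA G x = (2^-1 * dot x xs)%:E.
Proof.
move=> Gs Gx; rewrite /qA -[RHS]ereal_inf1; congr ereal_inf.
apply/seteqP; split=> [_ [ys Gy <-]|y ->] /=; last by exists xs.
by rewrite (Gs _ _ _ _ Gx Gy).
Qed.

Lemma qA_notin G x : ~ (exists xs, G x xs) -> qA G x = +oo%E.
Proof.
move=> Gx; rewrite /qA -ereal_inf0; congr ereal_inf.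
by apply/seteqP; split=> [y [ys Gy _]|//]; apply: Gx; exists ys.
Qed.

(** Half of the monotonicity inequality, whose two cross terms agree by symmetry. *)
Lemma qA_subgradient G u us v vs : classA G -> G u us -> G v vs ->
  dot (u - v) vs <= 2^-1 * dot u us - 2^-1 * dot v vs.
Proof.
case=> _ [Gm _] Gs Gu Gv.
have := Gm _ _ _ _ Gu Gv; rewrite !dotE (Gs _ _ _ _ Gv Gu); lra.
Qed.

(** The common form of both classes: arbitrary a for [setS], a = 0 for [setT_]. *)
Definition glq G a b c : V -> \bar R :=
  fun x => (qA G (x - a)%R + (dot b x)%:E + c%:E)%E.

Lemma glqE G a b c x us : symmetric_rel G -> G (x - a) us ->
  glq G a b c x = (2^-1 * dot (x - a) us + dot b x + c)%:E.
Proof. by move=> Gs Gx; rewrite /glq (qAE Gs Gx) !EFinD. Qed.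

Lemma glq_notin G a b c x : ~ (exists us, G (x - a) us) -> glq G a b c x = +oo%E.
Proof. by move=> Gx; rewrite /glq (qA_notin Gx). Qed.

(** If y - b is a value of [G] at v, the subgradient inequality bounds the supremum, attained at v +
    a. Otherwise some v with [G v 0] has <v, y - b> nonzero, and the objective is affine and
    unbounded along v. *)
Lemma fconj_glq G a b c : classA G ->
  fconj (glq G a b c) = glq (graph_inv G) b a (- dot a b - c).
Proof.
move=> cG; case: (cG) => lG _ Gs; apply/funext => y.
case: (pselect (exists v, graph_inv G (y - b) v)) => [[v Gv]|nGv].
  case: (classA_inv cG) => _ _ iGs; rewrite (glqE _ _ iGs Gv).
  apply/eqP; rewrite eq_le; apply/andP; split.
    apply: ge_ereal_sup => _ [x _ <-].
    case: (pselect (exists us, G (x - a) us)) => [[us Gu]|nGu]; last first.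
      by rewrite (glq_notin _ _ nGu) /= leNye.
    rewrite (glqE _ _ Gs Gu) -EFinB lee_fin.
    have := qA_subgradient cG Gu Gv.
    by rewrite !dotE (dotC x b) (dotC y v) (dotC b v); lra.
  apply: le_ereal_sup_tmp; eexists; first by exists (v + a).
  have Gv' : G (v + a - a) (y - b) by rewrite addrK.
  rewrite (glqE _ _ Gs Gv') -EFinB lee_fin addrK.
  by rewrite !dotE (dotC y v) (dotC b v) (dotC b a); lra.
rewrite (glq_notin _ _ nGv); apply/eqyP => A A0.
(* Otherwise [perp_perp] would put y - b in the range of [G]. *)
have [v vran vy] : exists2 v, (forall x xs, G x xs -> dot v xs = 0) & dot v (y - b) != 0.
  apply: contrapT => nv; apply: nGv.
  apply: (perp_perp (dom_linear_closed _)); first by case: (classA_inv cG).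
  move=> v vG; apply/eqP; apply: contraT => vy; exfalso; apply: nv.
  by exists v => // x xs Gx; apply: vG; exists x.
have Gv := classA_perp_ran cG vran.
(* With this t the objective at t v + a equals A. *)
pose t := (A + c - dot a (y - b)) / dot v (y - b).
apply: le_ereal_sup_tmp; eexists; first by exists (t *: v + a).
have Gtv : G (t *: v + a - a) 0.
  by rewrite addrK; case: lG => _ _ GZ; rewrite -(scaler0 _ t); exact: GZ.
rewrite (glqE _ _ Gs Gtv) -EFinB lee_fin.
have : t * dot v (y - b) = A + c - dot a (y - b) by rewrite mulfVK.
by rewrite !dotE (dotC b v) (dotC b a); lra.
Qed.

(** Inverting [G] and swapping a and b are involutions. Being a conjugate is what later yields
    convexity, semicontinuity and recovery from the envelope. *)
Lemma glq_biconj G a b c : classA G ->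
  glq G a b c = fconj (glq (graph_inv G) b a (- dot a b - c)).
Proof.
move=> cG; rewrite fconj_glq; last exact: classA_inv.
by congr glq; rewrite dotC; ring.
Qed.

Lemma proper_glq G a b c : classA G -> proper_fun (glq G a b c).
Proof.
case=> [[G0 _ _] _ Gs]; split=> [x|].
  case: (pselect (exists us, G (x - a) us)) => [[us Gu]|nGu].
    by rewrite (glqE _ _ Gs Gu).
  by rewrite (glq_notin _ _ nGu).
exists a; have G0' : G (a - a) 0 by rewrite subrr.
by rewrite (glqE _ _ Gs G0') ltry.
Qed.

Lemma fconj_ge f x y k : f x = k%:E -> ((dot x y - k)%:E <= fconj f y)%E.
Proof.
by move=> fx; apply: ereal_sup_ubound; exists x => //; rewrite fx.
Qed.

Lemma proper_finite f : proper_fun f -> exists x k, f x = k%:E.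
Proof.
case=> fN [x fx]; exists x, (fine (f x)); rewrite fineK //.
by rewrite fin_numE fN lt_eqF.
Qed.

Lemma convex_fconj f : proper_fun f -> convex_fun (fconj f).
Proof.
(* The finite value at w keeps [fconj f] above -oo everywhere. *)
move=> pf x y t /andP[t0 t1]; have [w [m fw]] := proper_finite pf.
have t1' : 0 < 1 - t by rewrite subr_gt0.
apply: ge_ereal_sup => _ [z _ <-].
case: pf => /(_ z); case fz : (f z) => [k| |] // _ _; last by rewrite leNye.
have := fconj_ge x fw; have := fconj_ge y fw.
have := fconj_ge x fz; have := fconj_ge y fz.
case: (fconj f x) => [p| |] //; last first.
  case: (fconj f y) => [q| |] // _ _ _ _.
    by rewrite gt0_muley ?lte_fin // addye // leey.
  by rewrite !gt0_muley ?lte_fin // leey.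
case: (fconj f y) => [q| |] //; last first.
  by move=> _ _ _ _; rewrite gt0_muley ?lte_fin // addey // leey.
rewrite -EFinB -!EFinM -EFinD !lee_fin !dotE => hq hp _ _.
by nra.
Qed.

Lemma lsc_fconj f : proper_fun f -> lsc_fun (fconj f).
Proof.
move=> pf x a /ereal_sup_gt[_ [z _ <-]].
case: pf => /(_ z); case fz : (f z) => [k| |] // _ _.
rewrite -EFinB lte_fin => az.
have nz : 0 < enorm z + 1 by rewrite ltr_wpDl ?enorm_ge0.
(* The gap of one affine minorant at x over a Lipschitz constant for it; the 1 covers z = 0. *)
exists ((dot z x - k - a) / (enorm z + 1)).
  by rewrite divr_gt0 // subr_gt0.
move=> y; rewrite ltr_pdivlMr // => yx.
apply: lt_le_trans (fconj_ge y fz); rewrite lte_fin.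
have /ler_normlP[+ _] := CauchySchwarz z (y - x).
have := enorm_ge0 (y - x); rewrite !dotE; nra.
Qed.

Lemma Gamma0_glq G a b c : classA G -> Gamma0 (glq G a b c).
Proof.
move=> cG; have cGi := classA_inv cG.
split; first exact: proper_glq.
- by rewrite glq_biconj //; apply: convex_fconj; exact: proper_glq.
- by rewrite glq_biconj //; apply: lsc_fconj; exact: proper_glq.
Qed.

Lemma setS_glq G a b c : classA G -> setS (glq G a b c).
Proof. by move=> cG; split; [exact: Gamma0_glq|exists G, a, b, c]. Qed.

Lemma setSP f : setS f -> exists G a b c, classA G /\ f = glq G a b c.
Proof. by case. Qed.

Lemma setT_glq G b c : classA G -> setT_ (glq G 0 b c).
Proof.
move=> cG; split; first exact: Gamma0_glq.
by exists G, b, c; split=> //; apply/funext => x; rewrite /glq subr0.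
Qed.

Lemma setTP f : setT_ f -> exists G b c, classA G /\ f = glq G 0 b c.
Proof.
case=> _ [G [b [c [cG ->]]]]; exists G, b, c; split=> //.
by apply/funext => x; rewrite /glq subr0.
Qed.

Lemma glq_scale l G a b c : 0 < l -> classA G ->
  (fun x => l%:E * glq G a b c x)%E = glq (graph_scale l G) a (l *: b) (l * c).
Proof.
move=> l0 cG; apply/funext => x; case: (cG) => _ _ Gs.
case: (classA_scale l0 cG) => _ _ lGs.
case: (pselect (exists us, G (x - a) us)) => [[us Gu]|nGu].
  have lGu : graph_scale l G (x - a) (l *: us) by exists us.
  rewrite (glqE _ _ Gs Gu) (glqE _ _ lGs lGu) -EFinM; congr EFin.
  by rewrite !dotE; ring.
rewrite (glq_notin _ _ nGu) gt0_muley ?lte_fin // glq_notin //.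
by case=> _ [us Gu _]; apply: nGu; exists us.
Qed.

Lemma glq_add G H b b' c c' : classA G -> classA H ->
  (fun x => glq G 0 b c x + glq H 0 b' c' x)%E =
  glq (graph_add G H) 0 (b + b') (c + c').
Proof.
move=> cG cH; apply/funext => x.
case: (cG) (cH) (classA_add cG cH) => _ _ Gs [_ _ Hs] [_ _ GHs].
have pG : glq G 0 b c x != -oo%E by case: (proper_glq 0 b c cG).
have pH : glq H 0 b' c' x != -oo%E by case: (proper_glq 0 b' c' cH).
case: (pselect (exists us, G (x - 0) us)) => [[us Gu]|nGu]; last first.
  rewrite (glq_notin _ _ nGu) addye // glq_notin //.
  by case=> _ [z [w [Gz _ _]]]; apply: nGu; exists z.
case: (pselect (exists us, H (x - 0) us)) => [[ws Hw]|nHw]; last first.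
  rewrite (glq_notin _ _ nHw) addey // glq_notin //.
  by case=> _ [z [w [_ Hw _]]]; apply: nHw; exists w.
have GHu : graph_add G H (x - 0) (us + ws) by exists us, ws.
rewrite (glqE _ _ Gs Gu) (glqE _ _ Hs Hw) (glqE _ _ GHs GHu) -EFinD; congr EFin.
by rewrite !dotDr !dotDl; ring.
Qed.

End LinearRelations.

(** * Resolvents and Moreau envelopes *)

Section MoreauEnvelope.
Variables (R : realType) (n : nat) (r : R).
Hypothesis r_gt0 : 0 < r.
Local Notation V := 'rV[R]_n.
Local Notation graph := (V -> V -> Prop).
Implicit Types (M : 'M[R]_n) (G : graph) (a b p x y z : V) (c s : R).
Implicit Types (f g : V -> \bar R).

Lemma dot_mulmx x y M : dot (x *m M) y = dot x (y *m M^T).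
Proof.
have dotmx u v : dot u v = (u *m v^T) ord0 ord0.
  by rewrite mxE; apply: eq_bigr => i _; rewrite mxE.
by rewrite !dotmx trmx_mul trmxK mulmxA.
Qed.

(* The matrices of the firmly nonexpansive symmetric maps, i.e. of the
   resolvents of the relations in [classA] (acting on row vectors). *)
Definition resolvent_mx M :=
  M^T = M /\ forall x, 0 <= dot (x *m M) (x - x *m M).

Lemma resolvent_sym M x y : resolvent_mx M -> dot x (y *m M) = dot y (x *m M).
Proof. by case=> MT _; rewrite dotC dot_mulmx MT. Qed.

(** The relation r (M^-1 - Id), with M^-1 taken as a relation; its points are the pairs (w M, r (w -
    w M)). *)
Definition resolvent_graph M : graph := fun y ys => y = (y + r^-1 *: ys) *m M.

Lemma classA_resolvent_graph M : resolvent_mx M -> classA (resolvent_graph M).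
Proof.
move=> rM; have r0 : r != 0 by rewrite gt_eqF.
have ysE y ys : r *: (y + r^-1 *: ys - y) = ys.
  by rewrite addrAC subrr add0r scalerA divff // scale1r.
have lG : linear_relation (resolvent_graph M).
  rewrite /resolvent_graph; split.
  - by rewrite scaler0 addr0 mul0mx.
  - move=> x xs y ys {1}-> {1}->.
    by rewrite -mulmxDl scalerDr addrACA.
  - move=> t x xs {1}->.
    by rewrite scalemxAl scalerDr !scalerA [t * _]mulrC.
have mG : monotone_rel (resolvent_graph M).
  move=> x xs y ys Gx Gy; case: lG => _ GD GZ.
  have := GD _ _ _ _ Gx (GZ (-1) _ _ Gy); rewrite !scaleN1r.
  set d := x - y; set e := xs - ys => Gd; set w := d + r^-1 *: e.
  have -> : e = r *: (w - w *m M) by rewrite -Gd ysE.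
  by rewrite Gd dotZr pmulr_rge0 //; case: rM.
split=> //; last first.
  move=> x xs y ys Gx Gy.
  have [w [xE xsE]] : exists w, x = w *m M /\ xs = r *: (w - w *m M).
    by exists (x + r^-1 *: xs); rewrite -Gx ysE.
  have [v [yE ysE']] : exists v, y = v *m M /\ ys = r *: (v - v *m M).
    by exists (y + r^-1 *: ys); rewrite -Gy ysE.
  rewrite xE xsE yE ysE' !dotE (dotC _ v) (dotC _ w) (resolvent_sym w v rM).
  by rewrite (dotC (w *m M)).
split=> // x xs Gx; rewrite /resolvent_graph.
(* Tested against the graph point with parameter z, the pairing is -r |x - z M|^2, which forces x =
   z M. *)
set z := x + r^-1 *: xs.
have Gz : resolvent_graph M (z *m M) (r *: (z - z *m M)).
  by rewrite /resolvent_graph scalerA mulVf // scale1r addrC subrK.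
have := Gx _ _ Gz.
have -> : xs - r *: (z - z *m M) = - r *: (x - z *m M).
  rewrite -{1}(ysE x xs) -/z -scalerBr scaleNr -scalerN; congr (_ *: _).
  by rewrite !opprB addrC addrA subrK.
rewrite dotZr nmulr_rge0 ?oppr_lt0 // => le0.
apply/eqP; rewrite -subr_eq0; apply/eqP/dot_eq0/eqP.
by rewrite eq_le le0 dot_ge0.
Qed.

(* Minty's theorem for linear relations: a vector orthogonal to the range of
   the identity plus G/r is fixed by G/r, hence null. *)
Lemma classA_resolvent G : classA G ->
  exists2 M, resolvent_mx M & forall x, G (x *m M) (r *: (x - x *m M)).
Proof.
move=> cG; case: (cG) => [[G0 GD GZ] [Gm Gmax] Gs].
have r0 : r != 0 by rewrite gt_eqF.
(* The range of Id + G/r. *)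
pose P w := exists y, G y (r *: (w - y)).
have lP : linear_closed P.
  split; first by exists 0; rewrite subr0 scaler0.
  - move=> x y [x' Gx] [y' Gy]; exists (x' + y').
    by rewrite opprD addrACA scalerDr; exact: GD.
  - move=> t x [x' Gx]; exists (t *: x').
    by rewrite -scalerBr scalerA mulrC -scalerA; exact: GZ.
have Pall w : P w.
  apply: (perp_perp lP) => v vP.
  suff -> : v = 0 by rewrite dot0l.
  have vG y ys : G y ys -> r * dot v y + dot v ys = 0.
    move=> Gy; have : P (y + r^-1 *: ys).
      by exists y; rewrite addrAC subrr add0r scalerA divff ?gt_eqF // scale1r.
    move/vP; rewrite !dotE => h.
    have -> : r * dot v y + dot v ys = r * (dot v y + r^-1 * dot v ys) by field.
    by rewrite h mulr0.
  (* By [vG] the pairing is r |v|^2 + <y, ys>, so maximality applies; [vG] at this new point then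
     reads 2 r |v|^2 = 0. *)
  have /vG : G v (r *: v).
    apply: Gmax => y ys Gy; have := vG _ _ Gy; have := classA_ge0 cG Gy.
    have := mulr_ge0 (ltW r_gt0) (dot_ge0 v).
    by rewrite !dotE (dotC y v); lra.
  rewrite dotZr => h; apply: dot_eq0; apply/eqP.
  have /eqP : r * dot v v = 0 by lra.
  by rewrite mulf_eq0 gt_eqF.
have [e eP] := choice Pall.
(* The rows are chosen values on the standard basis; linearity of the graph extends their property
   to all x. *)
pose M : 'M[R]_n := \matrix_i e (delta_mx 0 i).
have GM x : G (x *m M) (r *: (x - x *m M)).
  have Gsum (I : Type) (s : seq I) (u us : I -> V) :
      (forall i, G (u i) (us i)) -> G (\sum_(i <- s) u i) (\sum_(i <- s) us i).
    move=> Gu; elim: s => [|i s IH]; first by rewrite !big_nil.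
    by rewrite !big_cons; exact: GD.
  rewrite mulmx_sum_row {2}(row_sum_delta x) -sumrB scaler_sumr; apply: Gsum => i.
  by rewrite rowK -scalerBr scalerA mulrC -scalerA; exact: GZ.
exists M => //; split.
  have sym x y : dot (x *m M) y = dot x (y *m M).
    have := Gs _ _ _ _ (GM x) (GM y); rewrite !dotE (dotC (y *m M) (x *m M)) => h.
    have /(mulfI r0) : r * dot (x *m M) y = r * dot (y *m M) x by lra.
    by move=> ->; rewrite dotC.
  apply/matrixP => i j.
  have := sym (delta_mx 0 i) (delta_mx 0 j).
  by rewrite dot_delta dotC dot_delta -!rowE !mxE.
move=> x; have := classA_ge0 cG (GM x).
by rewrite dotZr pmulr_rge0.
Qed.

(** The envelope kept in the extended reals, so that finiteness can be proved; [env] is its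
    [fine]. *)
Definition moreau f x : \bar R :=
  ereal_inf [set (f y + (r / 2 * enorm (y - x) ^+ 2)%R%:E)%E | y in [set: V]].

Definition quad M p s x : R := r / 2 * dot x (x - x *m M) + dot p x + s.

(** The minimizer is y = z M + a, where r (x - y) is the subgradient r (z - z M) + b. *)
Lemma moreau_glq G a b c M x : resolvent_mx M ->
  classA G -> (forall x, G (x *m M) (r *: (x - x *m M))) ->
  let z := x - a - r^-1 *: b in
  moreau (glq G a b c) x =
  (r / 2 * dot z (z - z *m M) + dot b z + (dot b a + c + dot b b / (2 * r)))%:E.
Proof.
move=> rM cG GM z; case: (cG) => _ _ Gs.
have r0 : r != 0 by rewrite gt_eqF.
have xE : x = z + a + r^-1 *: b by rewrite /z addrAC !subrK.
clearbody z.
apply/eqP; rewrite eq_le; apply/andP; split.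
  apply: ge_ereal_inf; eexists; first by exists (z *m M + a).
  have Gz : G (z *m M + a - a) (r *: (z - z *m M)) by rewrite addrK.
  rewrite (glqE _ _ Gs Gz) -EFinD lee_fin addrK enorm_sq xE !dotE.
  rewrite (dotC (z *m M) z) (dotC a z) (dotC a (z *m M)) (dotC b z).
  rewrite (dotC b (z *m M)) (dotC b a).
  by rewrite le_eqVlt; apply/orP; left; apply/eqP; field.
apply: le_ereal_inf_tmp => _ [y _ <-].
case: (pselect (exists us, G (y - a) us)) => [[us Gu]|nGu]; last first.
  by rewrite (glq_notin _ _ nGu) addye // leey.
rewrite (glqE _ _ Gs Gu) -EFinD lee_fin enorm_sq.
have := qA_subgradient cG Gu (GM z).
have := mulr_ge0 (ltW r_gt0) (dot_ge0 (y - a - z *m M)).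
have -> : y = y - a + a by rewrite subrK.
rewrite addrK xE; move: (y - a) => u.
rewrite !dotE.
rewrite ?(dotC (z *m M) z) ?(dotC a z) ?(dotC a (z *m M)) ?(dotC b z).
rewrite ?(dotC b (z *m M)) ?(dotC b a) ?(dotC (z *m M) u) ?(dotC b u) ?(dotC z u) ?(dotC a u).
move=> h1 h2; rewrite -subr_ge0.
set T := (X in 0 <= X).
(* The excess over the minimum is the slack of the subgradient inequality plus (r/2) |u - z M|^2. *)
have -> : T = (2^-1 * dot u us - 2^-1 * (r * (dot z (z *m M) - dot (z *m M) (z *m M)))
   - (r * (dot u z - dot u (z *m M)) - r * (dot z (z *m M) - dot (z *m M) (z *m M)))) +
  2^-1 * (r * (dot u u - dot u (z *m M) *+ 2 + dot (z *m M) (z *m M))).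
  by rewrite /T; field.
apply: addr_ge0; first by lra.
by lra.
Qed.

Lemma moreau_setS f : setS f -> exists M p s, resolvent_mx M /\
  forall x, moreau f x = (quad M p s x)%:E.
Proof.
move=> /setSP[G [a [b [c [cG ->]]]]].
have [M rM GM] := classA_resolvent cG.
(* The coefficients come from expanding the formula of [moreau_glq] at z = x - u. *)
pose u := a + r^-1 *: b.
exists M, (b - r *: (u - u *m M)),
  (r / 2 * dot u (u - u *m M) - dot b u + (dot b a + c + dot b b / (2 * r))).
split=> // x; rewrite (moreau_glq _ _ _ _ rM) //=.
have -> : x - a - r^-1 *: b = x - u by rewrite opprD addrA.
clearbody u; congr EFin; rewrite /quad !mulmxBl !dotE (resolvent_sym u x rM).
rewrite (dotC u x) (dotC (u *m M) x).
by field; rewrite gt_eqF.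
Qed.

Lemma quad_moreau M p s : resolvent_mx M ->
  exists2 f, setS f & forall x, moreau f x = (quad M p s x)%:E.
Proof.
move=> rM; have cG := classA_resolvent_graph rM.
have GM x : resolvent_graph M (x *m M) (r *: (x - x *m M)).
  by rewrite /resolvent_graph scalerA mulVf ?gt_eqF // scale1r addrC subrK.
(* The shift -p/r cancels b/r, so that z = x in [moreau_glq]; the constant is adjusted to leave
   s. *)
exists (glq (resolvent_graph M) (- (r^-1 *: p)) p
   (s + dot p (r^-1 *: p) - dot p p / (2 * r))); first exact: setS_glq.
move=> x; rewrite (moreau_glq _ _ _ _ rM) // opprK addrK; congr EFin.
by rewrite /quad !dotE; ring.
Qed.

(* In terms of f = g*, every affine minorant of f is dominated at y by the
   right-hand side at the point y + z / r, where z is its slope. *)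
Lemma moreau_sup f g (h : V -> R) y : proper_fun g -> f = fconj g ->
  (forall x, moreau f x = (h x)%:E) ->
  f y = ereal_sup [set (h x - r / 2 * enorm (y - x) ^+ 2)%:E | x in [set: V]].
Proof.
move=> pg fE hE; have r0 : r != 0 by rewrite gt_eqF.
apply/eqP; rewrite eq_le; apply/andP; split.
  rewrite {1}fE; apply: ge_ereal_sup => _ [z _ <-].
  case: (pg) => /(_ z); case gz : (g z) => [k| |] // _ _; last by rewrite leNye.
  apply: le_ereal_sup_tmp; eexists; first by exists (y + r^-1 *: z).
  rewrite -EFinB lee_fin.
  (* The left-hand side is the envelope at y + z/r of the affine minorant <z, .> - k of f. *)
  suff : dot z (y + r^-1 *: z) - dot z z / (2 * r) - k <= h (y + r^-1 *: z).
    rewrite enorm_sq opprD addrA subrr add0r !dotE => hz.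
    apply: le_trans (lerB hz (lexx _)).
    by rewrite le_eqVlt; apply/orP; left; apply/eqP; field.
  move: (y + _) => x; rewrite -lee_fin -hE; apply: le_ereal_inf_tmp => _ [w _ <-].
  apply: (@le_trans _ _ ((dot z w - k)%:E + (r / 2 * enorm (w - x) ^+ 2)%:E)%E).
    rewrite -EFinD lee_fin enorm_sq.
    have := mulr_ge0 (ltW r_gt0) (dot_ge0 (w - x + r^-1 *: z)).
    rewrite !dotE (dotC w z) (dotC x z) (dotC x w) => h0.
    rewrite -subr_ge0; set T := (X in 0 <= X).
    set U := (X in 0 <= X) in h0.
    have -> : T = U / 2 by rewrite /T /U; field.
    by rewrite divr_ge0.
  by rewrite fE; apply: leeD => //; exact: fconj_ge gz.
apply: ge_ereal_sup => _ [x _ <-].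
have : ((h x)%:E <= f y + (r / 2 * enorm (y - x) ^+ 2)%:E)%E.
  by rewrite -hE; apply: ereal_inf_lbound; exists y.
case: (f y) => [k| |] //.
  by rewrite -EFinD !lee_fin lerBlDr.
by move=> _; rewrite leey.
Qed.

Lemma moreau_inj f g (h : V -> R) : setS f -> setS g ->
  (forall x, moreau f x = (h x)%:E) -> (forall x, moreau g x = (h x)%:E) -> f = g.
Proof.
move=> /setSP[G [a [b [c [cG ->]]]]] /setSP[G' [a' [b' [c' [cG' ->]]]]] hf hg.
apply/funext => y.
rewrite (moreau_sup _ _ (glq_biconj _ _ _ cG) hf); last first.
  by apply: proper_glq; exact: classA_inv.
rewrite [RHS](moreau_sup _ _ (glq_biconj _ _ _ cG') hg) //.
by apply: proper_glq; exact: classA_inv.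
Qed.

End MoreauEnvelope.

(** * Series with weights 2^-i and terms t / (1 + t) *)

Section WeightedSeries.
Variable R : realType.
Implicit Types (t : R) (a b c : nat -> R).

(** Partial sums of [AW_dist] for an abstract sequence of suprema; N is excluded, so N = 0 and N = 1
    both give the empty sum. *)
Definition aw_psum a (N : nat) : R :=
  \sum_(1 <= i < N) ((2 ^+ i)^-1 * (a i / (1 + a i))).

Lemma frac_ge0 t : 0 <= t -> 0 <= t / (1 + t).
Proof. by move=> t0; rewrite divr_ge0 // addr_ge0. Qed.

Lemma frac_le1 t : 0 <= t -> t / (1 + t) <= 1.
Proof. by move=> t0; rewrite ler_pdivrMr; lra. Qed.

Lemma frac_le t : 0 <= t -> t / (1 + t) <= t.
Proof. by move=> t0; rewrite ler_pdivrMr; nra. Qed.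

(** After clearing denominators the sides differ by (t1 + t2 - t) + 2 t1 t2 + t t1 t2. *)
Lemma frac_subadd t t1 t2 : 0 <= t -> 0 <= t1 -> 0 <= t2 -> t <= t1 + t2 ->
  t / (1 + t) <= t1 / (1 + t1) + t2 / (1 + t2).
Proof.
move=> t0 t10 t20 tt.
have h1 : 0 < 1 + t1 by lra.
have h2 : 0 < 1 + t2 by lra.
have -> : t1 / (1 + t1) + t2 / (1 + t2) =
    (t1 * (1 + t2) + t2 * (1 + t1)) / ((1 + t1) * (1 + t2)).
  by field; rewrite !gt_eqF.
have h : 0 < 1 + t by lra.
rewrite ler_pdivrMr // mulrAC ler_pdivlMr ?mulr_gt0 //.
have : 0 <= t1 * t2 by rewrite mulr_ge0.
have : 0 <= t * (t1 * t2) by rewrite !mulr_ge0.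
nra.
Qed.

Lemma pow2V_gt0 i : 0 < (2 ^+ i)^-1 :> R.
Proof. by rewrite invr_gt0 exprn_gt0. Qed.

Lemma pow2VS i : (2 ^+ i.+1)^-1 = (2 ^+ i)^-1 / 2 :> R.
Proof. by rewrite exprS invfM mulrC. Qed.

Lemma pow2V_small (e : R) : 0 < e -> exists K, (2 ^+ K)^-1 < e.
Proof.
move=> e0; exists (Num.bound e^-1).
rewrite invf_plt ?posrE ?exprn_gt0 //.
apply: lt_trans (archi_boundP _) _; first by rewrite invr_ge0 ltW.
by rewrite -natrX ltr_nat ltn_expl.
Qed.

Lemma aw_psumS a N : aw_psum a N.+2 = aw_psum a N.+1 + (2 ^+ N.+1)^-1 * (a N.+1 / (1 + a N.+1)).
Proof. by rewrite /aw_psum big_nat_recr. Qed.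

Lemma aw_psum1 a : aw_psum a 1 = 0.
Proof. by rewrite /aw_psum big_geq. Qed.

Lemma aw_psum0 a : aw_psum a 0 = 0.
Proof. by rewrite /aw_psum big_geq. Qed.

Section NonNegative.
Variable a : nat -> R.
Hypothesis a_ge0 : forall i, 0 <= a i.

Lemma aw_term_ge0 i : 0 <= (2 ^+ i)^-1 * (a i / (1 + a i)).
Proof. by rewrite mulr_ge0 ?frac_ge0 // ltW // pow2V_gt0. Qed.

Lemma aw_psum_nondecreasing : nondecreasing_seq (aw_psum a).
Proof.
apply/nondecreasing_seqP => -[|N]; first by rewrite aw_psum0 aw_psum1.
by rewrite aw_psumS lerDl aw_term_ge0.
Qed.

(** The first K fractions are at most e and the later ones at most 1, so the tail is bounded by
    2^-K. [low] and [high] carry the exact geometric sums through the inductions. *)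
Lemma aw_psum_split K (e : R) : 0 <= e ->
  (forall i, (0 < i <= K)%N -> a i <= e) -> forall N, aw_psum a N <= e + (2 ^+ K)^-1.
Proof.
move=> e0 aK.
have low N : (N <= K)%N -> aw_psum a N.+1 <= e * (1 - (2 ^+ N)^-1).
  elim: N => [_|N IH NK]; first by rewrite aw_psum1 expr0 invr1 subrr mulr0.
  rewrite aw_psumS pow2VS; have := IH (ltnW NK).
  have : a N.+1 / (1 + a N.+1) <= e by apply: le_trans (frac_le _) (aK _ _).
  have := pow2V_gt0 N; nra.
have high m : aw_psum a (K + m).+1 <= e * (1 - (2 ^+ K)^-1) + (2 ^+ K)^-1 - (2 ^+ (K + m))^-1.
  elim: m => [|m IH]; first by rewrite addn0 addrK low.
  rewrite addnS aw_psumS pow2VS.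
  have := frac_le1 (a_ge0 (K + m).+1); have := pow2V_gt0 (K + m); nra.
move=> N; apply: (@le_trans _ _ (aw_psum a (K + N).+1)).
  exact: aw_psum_nondecreasing (leqW (leq_addl K N)).
apply: le_trans (high N) _.
have := pow2V_gt0 K; have := pow2V_gt0 (K + N); nra.
Qed.

Lemma aw_psum_cvg : cvgn (aw_psum a).
Proof.
apply: nondecreasing_is_cvgn; first exact: aw_psum_nondecreasing.
(* With K = 0 the smallness condition is vacuous. *)
exists (0 + (2 ^+ 0)^-1) => _ [N _ <-]; apply: aw_psum_split => // i.
by case: i.
Qed.

Lemma aw_psum_le_lim N : aw_psum a N <= limn (aw_psum a).
Proof. exact: nondecreasing_cvgn_le aw_psum_nondecreasing aw_psum_cvg N. Qed.

Lemma aw_lim_le (e : R) : (forall N, aw_psum a N <= e) -> limn (aw_psum a) <= e.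
Proof. by move=> ae; apply: limr_le; [exact: aw_psum_cvg|exact: nearW]. Qed.

Lemma aw_lim_ge0 : 0 <= limn (aw_psum a).
Proof. by rewrite -(aw_psum0 a) aw_psum_le_lim. Qed.

Lemma aw_term_le_lim i : (0 < i)%N ->
  (2 ^+ i)^-1 * (a i / (1 + a i)) <= limn (aw_psum a).
Proof.
case: i => // i _; apply: le_trans (aw_psum_le_lim i.+2).
rewrite aw_psumS lerDr -(aw_psum0 a); exact: aw_psum_nondecreasing.
Qed.

(** A single term is at most the limit, and t / (1 + t) is increasing. *)
Lemma aw_lim_small i (e : R) : (0 < i)%N -> 0 < e ->
  limn (aw_psum a) < (2 ^+ i)^-1 * (e / (1 + e)) -> a i < e.
Proof.
move=> i0 e0 /(le_lt_trans (aw_term_le_lim i0)).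
have h : 0 < 1 + a i by have := a_ge0 i; lra.
have he : 0 < 1 + e by lra.
rewrite ltr_pM2l ?pow2V_gt0 // ltr_pdivrMr // mulrAC ltr_pdivlMr //.
lra.
Qed.

Lemma aw_lim_eq0 : limn (aw_psum a) = 0 -> forall i, (0 < i)%N -> a i = 0.
Proof.
move=> l0 i i0; apply/eqP; rewrite eq_le a_ge0 andbT; apply/ler_addgt0Pl => e e0.
rewrite addr0 ltW //; apply: (aw_lim_small i0 e0); rewrite l0.
by rewrite mulr_gt0 ?pow2V_gt0 // divr_gt0 //; lra.
Qed.

End NonNegative.

Lemma aw_lim_triangle a b c : (forall i, 0 <= a i) -> (forall i, 0 <= b i) ->
  (forall i, 0 <= c i) -> (forall i, a i <= b i + c i) ->
  limn (aw_psum a) <= limn (aw_psum b) + limn (aw_psum c).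
Proof.
move=> a0 b0 c0 abc; apply: aw_lim_le => // N.
apply: le_trans (lerD (aw_psum_le_lim b0 N) (aw_psum_le_lim c0 N)).
rewrite /aw_psum -big_split; apply: ler_sum => i _ /=.
by rewrite -mulrDr ler_pM2l ?pow2V_gt0 // frac_subadd.
Qed.

Lemma cauchy_seq_cvg (u : nat -> R) :
  (forall e, 0 < e -> exists N, forall k, (N <= k)%N -> `|u N - u k| < e) -> cvgn u.
Proof.
move=> uC; apply: R_complete; apply: cauchy_exP => e /uC[N uN].
by exists (u N); exists N.

Qed.

End WeightedSeries.

(** * Limits of quadratic envelopes, metric axioms and completeness *)

Section Completeness.
Variables (R : realType) (n : nat) (r : R).
Hypothesis r_gt0 : 0 < r.
Local Notation V := 'rV[R]_n.
Implicit Types (M : 'M[R]_n) (p x y : V) (s : R) (f g h : V -> \bar R).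

Lemma cvg_dot (a b : nat -> V) (A B : V) :
  (forall i, a k ord0 i @[k --> \oo] --> A ord0 i) ->
  (forall i, b k ord0 i @[k --> \oo] --> B ord0 i) ->
  dot (a k) (b k) @[k --> \oo] --> dot A B.
Proof.
move=> aA bB; apply: cvg_big => [|i _]; first exact: add_continuous.
by apply: cvgM; [exact: aA|exact: bB].
Qed.

Lemma cvg_mulmx_coord x (A : nat -> 'M[R]_n) M :
  (forall i j, A k i j @[k --> \oo] --> M i j) ->
  forall j, (x *m A k) ord0 j @[k --> \oo] --> (x *m M) ord0 j.
Proof.
move=> AM j; rewrite mxE; under eq_fun do rewrite mxE.
apply: cvg_big => [|i _]; first exact: add_continuous.
by apply: cvgM; [exact: cvg_cst|exact: AM].
Qed.

(** The affine part cancels in the mixed second difference, leaving r (<x, y> - <x, y M>). *)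
Lemma quad_polar M p s x y : resolvent_mx M -> dot x (y *m M) =
  dot x y - r^-1 * (quad r M p s (x + y) - quad r M p s x - quad r M p s y + quad r M p s 0).
Proof.
move=> rM; rewrite /quad mulmxDl mul0mx !dotE (resolvent_sym y x rM) (dotC y x).
by field; rewrite gt_eqF.
Qed.

(** The resolvent inequality gives 0 <= <x, x - x M> <= |x|^2. This bound makes the [sup] in
    [sup_ball] a genuine supremum. *)
Lemma quad_bound M p s (B : R) : resolvent_mx M -> exists C, forall x,
  enorm x <= B -> `|quad r M p s x| <= C.
Proof.
move=> [_ rM]; exists (r / 2 * B ^+ 2 + enorm p * B + `|s|) => x xB.
apply: le_trans (ler_normD _ _) _; rewrite lerD2r.
apply: le_trans (ler_normD _ _) _; apply: lerD; last first.
  by apply: le_trans (CauchySchwarz _ _) _; rewrite ler_wpM2l ?enorm_ge0.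
have r2 : 0 <= r / 2 by rewrite divr_ge0 // ltW.
rewrite normrM ger0_norm // ler_wpM2l //.
have := rM x; have := dot_ge0 (x *m M); have := dot_ge0 (x - x *m M).
rewrite !dotE (dotC (x *m M) x) => h1 h2 h3.
rewrite ger0_norm; last by lra.
apply: (@le_trans _ _ (dot x x)); first by lra.
by rewrite -enorm_sq lerXn2r ?nnegrE ?enorm_ge0 // (le_trans (enorm_ge0 x)).
Qed.

(* The coefficients are linear combinations of values of the functions, so
   they converge too. *)
Lemma quad_limit (A : nat -> 'M[R]_n) (p : nat -> V) (s : nat -> R) (h : V -> R) :
  (forall k, resolvent_mx (A k)) ->
  (forall x, quad r (A k) (p k) (s k) x @[k --> \oo] --> h x) ->
  exists M q t, resolvent_mx M /\ forall x, h x = quad r M q t x.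
Proof.
move=> rA qh.
(* The limit of the bilinear forms <x, y A_k>, read off from [quad_polar]. *)
pose beta x y := dot x y - r^-1 * (h (x + y) - h x - h y + h 0).
have cbeta x y : dot x (y *m A k) @[k --> \oo] --> beta x y.
  under eq_fun => k do rewrite (quad_polar (p k) (s k) x y (rA k)).
  apply: cvgB; first exact: cvg_cst.
  apply: cvgM; first exact: cvg_cst.
  by apply: cvgD => //; apply: cvgB => //; exact: cvgB.
pose M : 'M[R]_n := \matrix_(i, j) beta (delta_mx 0 j) (delta_mx 0 i).
have cM i j : A k i j @[k --> \oo] --> M i j.
  rewrite mxE; under eq_fun => k.
    have -> : A k i j = dot (delta_mx 0 j) (delta_mx 0 i *m A k).
      by rewrite dotC dot_delta -rowE mxE.
    over.
  exact: cbeta.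
have cxM x := cvg_mulmx_coord (x := x) cM.
have cxB x i : (x - x *m A k) ord0 i @[k --> \oo] --> (x - x *m M) ord0 i.
  have E (N : 'M[R]_n) : (x - x *m N) ord0 i = x ord0 i - (x *m N) ord0 i.
    by rewrite !mxE.
  rewrite E; under eq_fun do rewrite E.
  by apply: cvgB; [exact: cvg_cst|exact: cxM].
have cs : s k @[k --> \oo] --> h 0.
  by have := qh 0; under eq_fun do rewrite /quad dot0l dot0r mulr0 !add0r.
have cxx x : r / 2 * dot x (x - x *m A k) @[k --> \oo] --> r / 2 * dot x (x - x *m M).
  apply: cvgM; first exact: cvg_cst.
  apply: cvg_dot => i; first exact: cvg_cst.
  exact: cxB.
(* Removing the quadratic part and the constant isolates the linear part. *)
have cp x : dot (p k) x @[k --> \oo] --> h x - h 0 - r / 2 * dot x (x - x *m M).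
  under eq_fun => k.
    have -> : dot (p k) x = quad r (A k) (p k) (s k) x - s k - r / 2 * dot x (x - x *m A k).
      by rewrite /quad; ring.
    over.
  by apply: cvgB => //; exact: cvgB.
pose q : V := \row_i (h (delta_mx 0 i) - h 0 - r / 2 * dot (delta_mx 0 i)
   (delta_mx 0 i - delta_mx 0 i *m M)).
have cq i : p k ord0 i @[k --> \oo] --> q ord0 i.
  by rewrite mxE; under eq_fun do rewrite -dot_delta; exact: cp.
exists M, q, (h 0); split; first split.
- apply/matrixP => i j; rewrite mxE.
  apply: (cvg_unique _ (cM j i)) => //.
  have -> : (fun k => A k j i) = (fun k => A k i j).
    by apply/funext => k; case: (rA k) => /matrixP/(_ i j); rewrite mxE.
  exact: cM.
- move=> x; have cx := cvg_dot (cxM x) (cxB x).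
  by apply: (cvgr_to_ge cx); apply: nearW => k; case: (rA k).
- move=> x; apply: (cvg_unique _ (qh x)) => //.
  apply: cvgD => //; apply: cvgD; first exact: cxx.
  by apply: cvg_dot => // i; exact: cvg_cst.
Qed.

Lemma env_setS f : setS f -> exists M p s, resolvent_mx M /\
  forall x, env r f x = quad r M p s x.
Proof.
move=> /(moreau_setS r_gt0)[M [p [s [rM fE]]]]; exists M, p, s; split=> // x.
by rewrite /env -/(moreau r f x) fE.
Qed.

Lemma env_inj f g : setS f -> setS g -> (forall x, env r f x = env r g x) -> f = g.
Proof.
move=> Sf Sg fg.
have mE h : setS h -> forall x, moreau r h x = (env r h x)%:E.
  by move=> /(moreau_setS r_gt0)[M [p [s [_ hE]]]] x; rewrite /env -/(moreau r h x) hE.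
apply: (moreau_inj r_gt0 Sf Sg (mE _ Sf)) => x.
by rewrite fg mE.
Qed.

Let dist_set f g (i : nat) : set R :=
  [set `|env r f x - env r g x| | x in [set x : V | enorm x <= i%:R]].

Lemma enorm0 : enorm (0 : V) = 0.
Proof. by rewrite /enorm dot0l sqrtr0. Qed.

Lemma dist_set_neq0 f g i : dist_set f g i !=set0.
Proof. by exists `|env r f 0 - env r g 0|; exists 0 => //=; rewrite enorm0. Qed.

Lemma sup_ball_ge f g (i : nat) x : setS f -> setS g -> enorm x <= i%:R ->
  `|env r f x - env r g x| <= sup_ball r f g i.
Proof.
move=> /env_setS[M [p [s [rM fE]]]] /env_setS[M' [p' [s' [rM' gE]]]] xi.
have [C fC] := quad_bound p s i%:R rM; have [C' gC] := quad_bound p' s' i%:R rM'.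
apply: ub_le_sup; last by exists x.
exists (C + C') => _ [y yi <-]; apply: le_trans (ler_normB _ _) _.
by rewrite fE gE lerD ?fC ?gC.
Qed.

Lemma sup_ball_le f g (i : nat) (B : R) :
  (forall x, enorm x <= i%:R -> `|env r f x - env r g x| <= B) ->
  sup_ball r f g i <= B.
Proof.
move=> fgB; apply: ge_sup; first exact: dist_set_neq0.
by move=> _ [x xi <-]; exact: fgB.
Qed.

Lemma sup_ball_ge0 f g i : setS f -> setS g -> 0 <= sup_ball r f g i.
Proof.
move=> Sf Sg; apply: le_trans (sup_ball_ge (i := i) (x := 0) Sf Sg _) => //.
by rewrite enorm0.
Qed.

Lemma AW_distE f g : AW_dist r f g = limn (aw_psum (sup_ball r f g)).
Proof. by []. Qed.

(** The radius is positive because the series of [AW_dist] starts at 1. *)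
Lemma enorm_nat_bound x : exists2 i : nat, (0 < i)%N & enorm x <= i%:R.
Proof.
exists (Num.bound (enorm x)).+1 => //; apply: ltW.
apply: lt_trans (archi_boundP (enorm_ge0 x)) _.
by rewrite ltr_nat.
Qed.

Lemma AW_metric : metric_on (@setS R n) (AW_dist r).
Proof.
move=> f g h Sf Sg Sh; rewrite !AW_distE.
have fg0 i := sup_ball_ge0 i Sf Sg; have gh0 i := sup_ball_ge0 i Sg Sh.
split.
- exact: aw_lim_ge0.
- split=> [d0|<-].
    apply: env_inj => // x; have [i i0 xi] := enorm_nat_bound x.
    have := sup_ball_ge Sf Sg xi.
    by rewrite (aw_lim_eq0 fg0 d0 i0) normr_le0 subr_eq0 => /eqP.
  apply/eqP; rewrite eq_le aw_lim_ge0 => [|i]; last exact: sup_ball_ge0.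
  rewrite andbT; apply: aw_lim_le => [i|N]; first exact: sup_ball_ge0.
  rewrite /aw_psum big1 // => i _.
  suff -> : sup_ball r f f i = 0 by rewrite mul0r mulr0.
  apply/eqP; rewrite eq_le sup_ball_ge0 // andbT; apply: sup_ball_le => x _.
  by rewrite subrr normr0.
- congr (limn (aw_psum _)); apply/funext => i.
  apply/eqP; rewrite eq_le; apply/andP; split; apply: sup_ball_le => x xi;
    by rewrite distrC; exact: sup_ball_ge.
- apply: aw_lim_triangle => // i; first exact: sup_ball_ge0.
  apply: sup_ball_le => x xi; apply: le_trans (ler_distD (env r g x) _ _) _.
  by apply: lerD; exact: sup_ball_ge.
Qed.

Lemma AW_complete : complete_on (@setS R n) (AW_dist r).
Proof.
move=> u Su uC.
(* A d-Cauchy sequence has uniformly Cauchy envelopes on each ball; the threshold is the one of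
   [aw_lim_small]. *)
have unif (i : nat) (e : R) : (0 < i)%N -> 0 < e -> exists N, forall k m,
    (N <= k)%N -> (N <= m)%N -> forall x, enorm x <= i%:R ->
    `|env r (u k) x - env r (u m) x| < e.
  move=> i0 e0; have d0 : 0 < (2 ^+ i)^-1 * (e / (1 + e)).
    by rewrite mulr_gt0 ?pow2V_gt0 // divr_gt0 //; lra.
  have [N uN] := uC _ d0; exists N => k m Nk Nm x xi.
  apply: le_lt_trans (sup_ball_ge (Su k) (Su m) xi) _.
  have := uN k m Nk Nm; rewrite AW_distE; apply: aw_lim_small => // j.
  exact: sup_ball_ge0.
have ucvg x : cvgn (fun k => env r (u k) x).
  apply: cauchy_seq_cvg => e e0; have [i i0 xi] := enorm_nat_bound x.
  by have [N uN] := unif i e i0 e0; exists N => k Nk; exact: uN.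
pose h x := limn (fun k => env r (u k) x).
have [A rA] := choice (fun k => env_setS (Su k)).
have [p {}rA] := choice rA; have [s {}rA] := choice rA.
have [M [q [t [rM hE]]]] : exists M q t, resolvent_mx M /\ forall x, h x = quad r M q t x.
  apply: (@quad_limit A p s) => [k|x]; first by case: (rA k).
  have -> : (fun k => quad r (A k) (p k) (s k) x) = (fun k => env r (u k) x).
    by apply/funext => k; case: (rA k).
  exact: ucvg.
have [f Sf fE] := quad_moreau r_gt0 q t rM.
have fh x : env r f x = h x by rewrite /env -/(moreau r f x) fE hE.
exists f => // e e0.
(* The tail beyond K costs less than e/2, the first K terms at most e/4. The ball index [K.+1] below
   stays positive when K = 0. *)
have [K Ke] := pow2V_small (divr_gt0 e0 (ltr0Sn R 1)).
have e4 : 0 < e / 4 by lra.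
have [N uN] := unif K.+1 _ isT e4; exists N => k Nk; rewrite AW_distE.
apply: (@le_lt_trans _ _ (e / 4 + (2 ^+ K)^-1)); last by lra.
have uf0 i := sup_ball_ge0 i (Su k) Sf.
apply: aw_lim_le => //; apply: aw_psum_split => //; first exact: ltW.
move=> i /andP[_ iK]; apply: sup_ball_le => x xi; rewrite fh.
(* Letting m tend to infinity in the uniform Cauchy estimate bounds the distance to the limit. *)
have cx : `|env r (u k) x - env r (u m) x| @[m --> \oo] --> `|env r (u k) x - h x|.
  by apply: cvg_norm; apply: cvgB; [exact: cvg_cst|exact: ucvg].
apply: (cvgr_to_le cx); exists N => // m /= Nm; apply/ltW/uN => //; apply: le_trans xi _.
by rewrite ler_nat leqW.
Qed.

End Completeness.

(** * Closure of S and T under the operations, together with completeness of S *)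

Theorem theorem5p10 (R : realType) (n : nat) (r : R) (hr : 0 < r) :
  [/\ (metric_on (@setS R n) (AW_dist r) /\ complete_on (@setS R n) (AW_dist r)),
      (forall f, @setS R n f -> @setS R n (fconj f)),
      (forall (f : 'rV[R]_n -> \bar R) G a (c : R),
         classA G -> f = (fun x => qA G (x - a)%R + c%:E)%E -> Gamma0 f ->
         setT_ (fconj f)),
      (forall (f : 'rV[R]_n -> \bar R) (l : R), 0 < l ->
         (setS f -> setS (fun x => l%:E * f x)%E) /\
         (setT_ f -> setT_ (fun x => l%:E * f x)%E))
    & (forall f1 f2 : 'rV[R]_n -> \bar R, setT_ f1 -> setT_ f2 ->
         setT_ (fun x => f1 x + f2 x)%E)].
Proof.
split; first by split; [exact: AW_metric|exact: AW_complete].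
- move=> f /setSP[G [a [b [c [cG ->]]]]]; rewrite fconj_glq //.
  by apply: setS_glq; exact: classA_inv.
- move=> f G a c cG fE _.
  (* Conjugation exchanges shift and slope, so slope 0 becomes shift 0. *)
  have -> : f = glq G a 0 c.
    by rewrite fE; apply/funext => x; rewrite /glq dot0l adde0.
  by rewrite fconj_glq //; apply: setT_glq; exact: classA_inv.
- move=> f l l0; split.
    move=> /setSP[G [a [b [c [cG ->]]]]]; rewrite glq_scale //.
    by apply: setS_glq; exact: classA_scale.
  move=> /setTP[G [b [c [cG ->]]]]; rewrite glq_scale //.
  by apply: setT_glq; exact: classA_scale.
- move=> f1 f2 /setTP[G [b [c [cG ->]]]] /setTP[H [b' [c' [cH ->]]]].
  by rewrite glq_add //; apply: setT_glq; exact: classA_add.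
Qed.
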